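(* Let $L$ be a $1$-bounded, one-sorted metric signature containing only predicate and constant symbols (no function symbols). Then an $L$-structure is pseudofinite if and only if it is pseudocompact.
   Context: Continuous first-order logic for metric structures (Ben Yaacov–Berenstein–Henson–Usvyatsov) is used. For a $1$-bounded one-sorted metric signature $L$, $L$-structures are complete metric spaces of diameter at most $1$ with interpretations of the symbols; predicates are $[0,1]$-valued, and each predicate symbol $P$ has a modulus $\Delta_P$: $d(a,b)<\Delta_P(\epsilon)$ implies $|P(a)-P(b)|\le\epsilon$ (tuples carry the maximum metric). Connectives are all continuous functions $[0,1]^n\to[0,1]$, quantifiers are $\sup$ and $\inf$. The value of a sentence $\sigma$ in $M$ is $\sigma^M\in[0,1]$. An $L$-structure is finite (resp. compact) if its underlying metric space is. An $L$-structure $M$ is pseudofinite (resp. pseudocompact) if $\sigma^M=0$ for every $L$-sentence $\sigma$ such that $\sigma^A=0$ for all finite (resp. compact) $L$-structures $A$. *)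

(* Defs.v *)
From HB Require Import structures.
From mathcomp Require Import all_boot all_order all_algebra.
From mathcomp Require Import all_classical all_reals all_analysis.

Set Implicit Arguments.
Unset Strict Implicit.
Unset Printing Implicit Defensive.

Import Order.TTheory GRing.Theory Num.Theory.
Import numFieldNormedType.Exports.

Local Open Scope classical_set_scope.
Local Open Scope ring_scope.

(* A modulus is a function ]0, 1] -> ]0, 1], encoded as a function on [R] whose
   values outside ]0, 1] are irrelevant. *)
Record signature (R : realType) := Signature {
  pred_symb : Type;
  const_symb : Type;
  arity : pred_symb -> nat;
  modulus : pred_symb -> R -> R;
  modulus_range : forall P e, 0 < e <= 1 -> 0 < modulus P e <= 1
}.

Definition tuple_dist (R : realType) (M : metricType R) (n : nat)
    (a b : n.-tuple M) : R :=
  \big[Num.max/0]_(i < n) mdist (tnth a i) (tnth b i).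

(* Structures are nonempty, as is usual in continuous logic.  Completeness is
   the library's [cauchy_cvg], which cannot be reused directly because
   [completeType] also carries a distinguished point. *)
Record structure (R : realType) (L : signature R) := Structure {
  carrier :> metricType R;
  carrier_nonempty : [set: carrier] !=set0;
  carrier_complete : forall F : set_system carrier,
    ProperFilter F -> cauchy F -> exists l : carrier, F --> l;
  carrier_diam : forall x y : carrier, mdist x y <= 1;
  interp_const : const_symb L -> carrier;
  interp_pred : forall P : pred_symb L, (arity P).-tuple carrier -> R;
  interp_pred_range : forall P (a : (arity P).-tuple carrier),
    0 <= interp_pred a <= 1;
  interp_pred_modulus :
    forall P (e : R) (a b : (arity P).-tuple carrier), 0 < e <= 1 ->
      tuple_dist a b < modulus P e -> `|interp_pred a - interp_pred b| <= e
}.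

Definition unit_cube (R : realType) (n : nat) : set 'rV[R]_n :=
  [set x | forall i, 0 <= x ord0 i <= 1].

(* A continuous function [0, 1]^n -> [0, 1]; the values of the underlying
   function outside the unit cube are irrelevant. *)
Record connective (R : realType) (n : nat) := Connective {
  connective_fun :> 'rV[R]_n -> R;
  connective_continuous : {within @unit_cube R n, continuous connective_fun};
  connective_range : forall x, unit_cube x -> 0 <= connective_fun x <= 1
}.

Section Syntax.
Context {R : realType} (L : signature R).

(* [term k] and [formula k] have their free variables among k de Bruijn
   indices; the quantifiers bind index 0. *)
Inductive term (k : nat) :=
| Var of 'I_k
| Const of const_symb L.

Inductive formula (k : nat) :=
| Dist of term k & term k
| Pred (P : pred_symb L) of (arity P).-tuple (term k)
| Conn (n : nat) of connective R n & ('I_n -> formula k)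
| Sup of formula k.+1
| Inf of formula k.+1.

Definition sentence := formula 0.

End Syntax.

Section Semantics.
Context {R : realType} {L : signature R} (M : structure L).

Definition eval_term (k : nat) (v : k.-tuple M) (t : term L k) : M :=
  match t with
  | Var i => tnth v i
  | Const c => interp_const M c
  end.

Fixpoint eval (k : nat) (phi : formula L k) : k.-tuple M -> R :=
  match phi with
  | Dist t1 t2 => fun v => mdist (eval_term v t1) (eval_term v t2)
  | Pred P ts => fun v => interp_pred (map_tuple (eval_term v) ts)
  | Conn n u phis => fun v => u (\row_(i < n) eval (phis i) v)
  | Sup psi => fun v => sup (range (fun a : M => eval psi (cons_tuple a v)))
  | Inf psi => fun v => inf (range (fun a : M => eval psi (cons_tuple a v)))
  end.

Definition value (sigma : sentence L) : R := eval sigma (nil_tuple M).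

Definition finite_structure : Prop := finite_set [set: M].

Definition compact_structure : Prop := compact [set: M].

End Semantics.

Definition pseudofinite (R : realType) (L : signature R) (M : structure L) :=
  forall sigma : sentence L,
    (forall A : structure L, finite_structure A -> value A sigma = 0) ->
    value M sigma = 0.

Definition pseudocompact (R : realType) (L : signature R) (M : structure L) :=
  forall sigma : sentence L,
    (forall A : structure L, compact_structure A -> value A sigma = 0) ->
    value M sigma = 0.

(* Main.v *)
(* Finite structures are compact, so it suffices that the value of a sentence
   in a compact structure [A] is a limit of its values in finite structures.
   Without function symbols, a finite d-net of [A] is a structure for the
   restricted metric and predicates once each constant is moved to a point of
   the net at distance less than d; by uniform continuity of predicates and
   connectives, its values of a given formula are close to those in [A] when d
   is small. *)
From HB Require Import structures.
Require Import Defs.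
From mathcomp Require Import all_boot all_order all_algebra.
From mathcomp Require Import all_classical all_reals all_analysis.
From mathcomp Require Import finmap lra.

Set Implicit Arguments.
Unset Strict Implicit.
Unset Printing Implicit Defensive.

Import Order.TTheory GRing.Theory Num.Theory.
Import numFieldNormedType.Exports.
(* Restores [eval], which [all_analysis] shadows. *)
Import Defs.

Local Open Scope classical_set_scope.
Local Open Scope ring_scope.

Section SubsetMetric.
Context {R : realType} {X : metricType R} (A : set X).

Let subset_dist (x y : A) : R := mdist (\val x) (\val y).

Let subset_dist_ge0 x y : 0 <= subset_dist x y.
Proof. exact: mdist_ge0. Qed.

Let subset_dist_positivity x y : subset_dist x y = 0 -> x = y.
Proof. by move=> /mdist_positivity /val_inj. Qed.

Let ball_subset_dist x d : ball x d = [set y | subset_dist x y < d].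
Proof.
transitivity [set y : A | ball (\val x) d (\val y)]; first by [].
by rewrite ballEmdist.
Qed.

HB.instance Definition _ := @PseudoMetric_isMetric.Build R A
  subset_dist subset_dist_ge0 subset_dist_positivity ball_subset_dist.

End SubsetMetric.

(** * Metric and compactness preliminaries *)

Lemma ler_dist_mdist (R : realType) (X : metricType R) (x y x' y' : X) :
  `|mdist x y - mdist x' y'| <= mdist x x' + mdist y y'.
Proof.
have := metric_triangle x x' y; have := metric_triangle x' y' y.
have := metric_triangle x' x y'; have := metric_triangle x y y'.
rewrite (metric_sym x' x) (metric_sym y' y) => ? ? ? ?.
by rewrite ler_norml; apply/andP; split; lra.
Qed.

(** A finite space is compact, and Cauchy filters converge in compact spaces. This supplies the
    completeness of finite structures. *)
Lemma finite_cauchy_cvg (T : uniformType) (F : set_system T) :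
  finite_set [set: T] -> ProperFilter F -> cauchy F -> exists l : T, F --> l.
Proof.
(* Properness of [F] yields a point, which turns [T] into a pointed space. *)
move=> finT PF cF; have [x0 _] := filter_ex (@filterT _ F _).
pose pT := HB.pack_for puniformType T (isPointed.Build T x0).
have cT : compact [set: pT] by exact: finite_compact.
exact: (cvg_ex _).1 (@compact_cauchy_cvg pT setT F PF cF filterT cT).
Qed.

(** The interiors of the [d]-balls form an open cover; the centres of a finite subcover are the
    net. *)
Lemma compact_finite_net (R : realType) (X : metricType R) (d : R) :
  [set: X] !=set0 -> compact [set: X] -> 0 < d ->
  exists A : set X, [/\ finite_set A, A !=set0 &
    forall x, exists2 a, A a & mdist a x < d].
Proof.
move=> [x0 _] cX d0.
pose pX := HB.pack_for ptopologicalType X (isPointed.Build X x0).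
have : @cover_compact pX setT by rewrite -compact_cover.
case/(_ X setT (fun x => (ball x d)°)).
- by move=> x _; exact: open_interior.
- by move=> x _; exists x => //; exact: nbhsx_ballx.
move=> S _ SX.
have net x : exists2 a, [set` S] a & mdist a x < d.
  have [a Sa /interior_subset] := SX x I.
  by rewrite ballEmdist; exists a.
exists [set` S]; split => //.
by have [a Sa _] := net x0; exists a.
Qed.

(** Heine-Cantor on the cube, which is compact as a finite product of segments. *)
Lemma connective_unif_continuous (R : realType) n (u : connective R n) (e : R) :
  0 < e -> exists2 d : R, 0 < d & forall x y, unit_cube x -> unit_cube y ->
    (forall i, `|x ord0 i - y ord0 i| < d) -> `|u x - u y| <= e.
Proof.
move=> e0.
have : compact (@unit_cube R n).
  have -> : @unit_cube R n = [set v | forall i, `[0, 1]%classic (v ord0 i)].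
    by apply/seteqP; split => v /= H i; have := H i; rewrite in_itv.
  apply: (@rV_compact R n (fun=> `[0, 1]%classic)) => i.
  exact: segment_compact.
(* In near-covering form, compactness turns an estimate valid for points near each [x] and all small
   [d] into one [d] for the whole cube. *)
move/compact_near_coveringP/near_covering_withinP.
move=> /(_ R (0 : R)^'+ (fun d x => forall y, unit_cube y ->
    (forall i, `|x ord0 i - y ord0 i| < d) -> `|u x - u y| <= e) _) cov.
near (0 : R)^'+ => d; exists d => // x y Cx; move: x Cx y; near: d.
apply: cov => x Cx.
have /(subspace_continuousP _ _).1/(_ _ Cx) := @connective_continuous R n u.
move=> /cvgrPdist_lt /(_ (e / 2)); rewrite divr_gt0// => /(_ isT).
rewrite near_withinE => /nbhs_ballP[r /= r0 ur].
have r20 : 0 < r / 2 by rewrite divr_gt0.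
(* With [y] within [r / 2] of [x] and [z] within [r / 2] of [y], both lie in the [r]-ball where [u]
   differs from [u x] by less than [e / 2]. *)
exists (ball x (r / 2), [set d | d < r / 2]) => /=.
  by split; [exact: nbhsx_ballx|exact: nbhs_right_lt].
move=> [y d] /= [[_ xy] dr] Cy z Cz yz.
have xz : ball x r z.
  split => // i j; rewrite (ord1 i); apply: (@ball_splitr _ _ (y ord0 j)).
    by apply: ball_sym; exact: xy.
  by rewrite /ball /=; apply: lt_trans (yz j) dr.
have {}xy : ball x r y by apply: (@le_ball _ _ x (r / 2)) => //; lra.
have := ur y xy Cy; have := ur z xz Cz.
rewrite (distrC (u x) (u y)); have := ler_distD (u x) (u y) (u z).
by lra.
Unshelve. all: by end_near.
Qed.

(** * Suprema and infima over different index types *)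

Lemma sup_range_approx (R : realType) (S T : Type) (g : S -> R) (h : T -> R)
    (e : R) :
  [set: S] !=set0 -> has_ubound (range h) ->
  (forall s, exists t, `|g s - h t| <= e) -> sup (range g) <= sup (range h) + e.
Proof.
move=> [s0 _] ubh gh; apply: ge_sup; first by exists (g s0), s0.
move=> _ [s _ <-]; have [t gst] := gh s.
have := @ub_le_sup _ (range h) ubh (h t) (ex_intro2 _ _ t I erefl).
by move: gst; rewrite ler_norml => /andP[]; lra.
Qed.

Lemma dist_sup_range (R : realType) (S T : Type) (g : S -> R) (h : T -> R)
    (e : R) :
  [set: S] !=set0 -> [set: T] !=set0 ->
  has_ubound (range g) -> has_ubound (range h) ->
  (forall s, exists t, `|g s - h t| <= e) ->
  (forall t, exists s, `|g s - h t| <= e) ->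
  `|sup (range g) - sup (range h)| <= e.
Proof.
move=> S0 T0 ubg ubh gh hg.
have := sup_range_approx S0 ubh gh.
have /(sup_range_approx T0 ubg) : forall t, exists s, `|h t - g s| <= e.
  by move=> t; have [s] := hg t; exists s; rewrite distrC.
by move=> ? ?; rewrite ler_norml; apply/andP; split; lra.
Qed.

(** Reduces the [Inf] case to the estimate for suprema. *)
Lemma inf_rangeN (R : realType) (T : Type) (h : T -> R) :
  inf (range h) = - sup (range (\- h)).
Proof. by rewrite /inf image_comp. Qed.

(** * Values of formulas under approximation *)

Section Values.
Context {R : realType} {L : signature R}.
Implicit Types M A B : structure L.

(** Keeps the arguments of connectives inside the unit cube, and bounds the ranges under quantifiers
    so that [sup] and [inf] are genuine rather than default values. *)
Lemma eval_range M k (phi : formula L k) (v : k.-tuple M) :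
  0 <= eval phi v <= 1.
Proof.
have [a0 _] := carrier_nonempty M.
elim: phi v => {k} [k t1 t2|k P ts|k n u phis IH|k psi IH|k psi IH] v /=.
- by rewrite mdist_ge0 carrier_diam.
- exact: interp_pred_range.
- by apply: connective_range => i; rewrite mxE.
- apply/andP; split.
    apply: le_trans (_ : eval psi (cons_tuple a0 v) <= _).
      by have /andP[] := IH (cons_tuple a0 v).
    apply: ub_le_sup; last by exists a0.
    by exists 1 => _ [a _ <-]; have /andP[] := IH (cons_tuple a v).
  apply: ge_sup; first by exists (eval psi (cons_tuple a0 v)), a0.
  by move=> _ [a _ <-]; have /andP[] := IH (cons_tuple a v).
- apply/andP; split.
    apply: lb_le_inf; first by exists (eval psi (cons_tuple a0 v)), a0.
    by move=> _ [a _ <-]; have /andP[] := IH (cons_tuple a v).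
  apply: le_trans (_ : eval psi (cons_tuple a0 v) <= _); last first.
    by have /andP[] := IH (cons_tuple a0 v).
  apply: ge_inf; last by exists a0.
  by exists 0 => _ [a _ <-]; have /andP[] := IH (cons_tuple a v).
Qed.

(** Constants are matched only up to [d] because a net of [A] need not contain them; metric and
    predicates can be restricted exactly. *)
Record approximation A B (d : R) (f : B -> A) := Approximation {
  approx_mdist : forall x y, mdist (f x) (f y) = mdist x y;
  approx_pred : forall P (a : (arity P).-tuple B),
    interp_pred (map_tuple f a) = interp_pred a;
  approx_const : forall c, mdist (f (interp_const B c)) (interp_const A c) < d;
  approx_net : forall a, exists b, mdist (f b) a < d
}.

Lemma approximation_le A B (d d' : R) (f : B -> A) :
  d <= d' -> approximation d f -> approximation d' f.
Proof.
move=> dd' [fd fP fc fn]; split => // [c|a]; first exact: lt_le_trans dd'.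
by have [b ?] := fn a; exists b; exact: lt_le_trans dd'.
Qed.

(** A term is a variable or a constant, so evaluation does not enlarge the error [d]. The absence of
    function symbols is used here. *)
Lemma mdist_eval_term A B (d : R) (f : B -> A) k
    (v : k.-tuple B) (w : k.-tuple A) (t : term L k) : approximation d f ->
  (forall i, mdist (f (tnth v i)) (tnth w i) < d) ->
  mdist (f (eval_term v t)) (eval_term w t) < d.
Proof.
by move=> fP vw; case: t => [i|c] /=; [exact: vw|exact: approx_const].
Qed.

(* The assignments [v] and [w] differ by up to [d], so the induction proves
   at once that [eval] is uniformly continuous and stable under approximation. *)
Lemma eval_approximation A k (phi : formula L k) (e : R) : 0 < e ->
  exists2 d : R, 0 < d & forall B (f : B -> A), approximation d f ->
    forall (v : k.-tuple B) (w : k.-tuple A),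
    (forall i, mdist (f (tnth v i)) (tnth w i) < d) ->
    `|eval phi v - eval phi w| <= e.
Proof.
elim: phi e => {k} [k t1 t2|k P ts|k n u phis IH|k psi IH|k psi IH] e e0 /=.
- exists (e / 2); first by rewrite divr_gt0.
  move=> B f fP v w vw.
  have := mdist_eval_term t1 fP vw; have := mdist_eval_term t2 fP vw.
  rewrite -(approx_mdist fP).
  have := ler_dist_mdist (f (eval_term v t1)) (f (eval_term v t2))
    (eval_term w t1) (eval_term w t2).
  by lra.
(* The modulus is only meaningful on ]0, 1], hence the cap at 1. *)
- have e1 : 0 < Num.min e 1 <= 1 by rewrite lt_min e0 ltr01 ge_min lexx orbT.
  have /andP[d0 _] := modulus_range P e1.
  exists (modulus P (Num.min e 1)) => // B f fP v w vw.
  rewrite -(approx_pred fP); apply: (@le_trans _ _ (Num.min e 1)); last first.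
    by rewrite ge_min lexx.
  apply: interp_pred_modulus => //; apply/bigmax_ltP; split => // i _.
  by rewrite !tnth_map; exact: mdist_eval_term.
- have [d d0 ud] := connective_unif_continuous u e0.
  (* Induction gives a non-strict bound where [ud] asks for a strict one, so [d / 2] is
     requested. *)
  have d20 : 0 < d / 2 by rewrite divr_gt0.
  have /fin_all_exists2[D D0 DP] := fun i => IH i _ d20.
  (* The default 1 keeps [m] positive even for a connective of arity 0. *)
  pose m := \big[Num.min/1]_i D i.
  have mD i : m <= D i by exact: bigmin_le_cond.
  exists m; first by apply/bigmin_gtP; split.
  move=> B f fP v w vw; apply: ud => [i|i|i]; rewrite ?mxE ?eval_range//.
  apply: (@le_lt_trans _ _ (d / 2)); last lra.
  apply: (DP i B f); first exact: approximation_le fP.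
  by move=> j; exact: lt_le_trans (mD i).
- have [d d0 dP] := IH _ e0; exists d => // B f fP v w vw.
  (* Assignments may be extended by any pair with [f b] close to [a]: each [b] is paired with [f b],
     each [a] with a point given by the net. *)
  have cons a b : mdist (f b) a < d ->
      `|eval psi (cons_tuple b v) - eval psi (cons_tuple a w)| <= e.
    move=> ba; apply: dP fP _ _ _ => i.
    by case: (unliftP ord0 i) => [j ->|->]; rewrite ?tnth0 // !tnthS.
  apply: dist_sup_range; try exact: carrier_nonempty.
  + by exists 1 => _ [a _ <-]; have /andP[] := eval_range psi (cons_tuple a v).
  + by exists 1 => _ [a _ <-]; have /andP[] := eval_range psi (cons_tuple a w).
  + by move=> b; exists (f b); apply: cons; rewrite mdistxx.
  + by move=> a; have [b ba] := approx_net fP a; exists b; exact: cons.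
- have [d d0 dP] := IH _ e0; exists d => // B f fP v w vw.
  have cons a b : mdist (f b) a < d ->
      `|- eval psi (cons_tuple b v) - - eval psi (cons_tuple a w)| <= e.
    move=> ba; rewrite -opprD normrN; apply: dP fP _ _ _ => i.
    by case: (unliftP ord0 i) => [j ->|->]; rewrite ?tnth0 // !tnthS.
  rewrite !inf_rangeN -opprD normrN.
  apply: dist_sup_range; try exact: carrier_nonempty.
  + exists 0 => _ [a _ <-]; rewrite oppr_le0.
    by have /andP[] := eval_range psi (cons_tuple a v).
  + exists 0 => _ [a _ <-]; rewrite oppr_le0.
    by have /andP[] := eval_range psi (cons_tuple a w).
  + by move=> b; exists (f b); apply: cons; rewrite mdistxx.
  + by move=> a; have [b ba] := approx_net fP a; exists b; exact: cons.
Qed.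

(** With no operations to be closed under, a finite net becomes a structure as soon as the constants
    are relocated; the map is [\val]. *)
Lemma finite_approximation A (d : R) : compact_structure A -> 0 < d ->
  exists B, finite_structure B /\ exists f : B -> A, approximation d f.
Proof.
move=> cA d0; have [S [finS [s0 Ss0] net]] :=
  compact_finite_net (carrier_nonempty A) cA d0.
(* [g] serves twice: it places the constants, and it witnesses that the net reaches every point of
   [A]. *)
have /choice[g gP] (a : A) : exists s : S, mdist (\val s) a < d.
  by have [s Ss sa] := net a; exists (SigSub (mem_set Ss)).
have finST : finite_set [set: S].
  by rewrite (eq_finite_set (card_setT S)).
have nonempty : [set: S] !=set0 by exists (SigSub (mem_set Ss0)).
have diam (x y : S) : mdist x y <= 1 by exact: carrier_diam.
pose pred P (a : (arity P).-tuple S) := interp_pred (map_tuple \val a) : R.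
have pred_range P (a : (arity P).-tuple S) : 0 <= pred P a <= 1.
  exact: interp_pred_range.
have pred_modulus P (e : R) (a b : (arity P).-tuple S) : 0 < e <= 1 ->
    tuple_dist a b < modulus P e -> `|pred P a - pred P b| <= e.
  move=> e01 ab; apply: interp_pred_modulus => //; move: ab.
  by congr (_ < _); apply: eq_bigr => i _; rewrite !tnth_map.
exists (Structure nonempty (fun F => @finite_cauchy_cvg S F finST) diam
  (fun c => g (interp_const A c)) pred_range pred_modulus).
split => //; exists \val; split => // [c|a]; first exact: gP.
by exists (g a).
Qed.

Lemma value_compact_eq0 (sigma : sentence L) :
  (forall B, finite_structure B -> value B sigma = 0) ->
  forall A, compact_structure A -> value A sigma = 0.
Proof.
move=> finB A cA; apply/eqP; rewrite -normr_le0.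
apply/ler_addgt0Pr => e e0; rewrite add0r.
have [d d0 dP] := eval_approximation A sigma e0.
have [B [Bfin [f fP]]] := finite_approximation cA d0.
have := dP B f fP (nil_tuple B) (nil_tuple A).
rewrite -/(value B sigma) finB// sub0r normrN; apply.
(* A sentence has no free variables, so closeness of the assignments is a condition over the empty
   ['I_0]. *)
by case.
Qed.

End Values.

Theorem theorem5p1 (R : realType) (L : signature R) (M : structure L) :
  pseudofinite M <-> pseudocompact M.
Proof.
split=> psM sigma sigma0; apply: psM; last exact: value_compact_eq0.
by move=> A finA; apply: sigma0; exact: finite_compact.
Qed.
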